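(* Let $n\ge0$ and let $G$ be a group of type $F_{n+1}$. Assume that $\Delta_n$ has a spectral gap in $\mathbb{M}_{k}(C^*_r(G))$, $k=k_n$, i.e. its spectrum is contained in $\{0\}\cup[\epsilon,\infty)$ for some $\epsilon>0$, and let $p_n\in\mathbb{M}_k(C^*_r(G))$ be the Kazhdan projection in degree $n$. Then $$\tau_*([p_n])=\beta_{(2)}^n(G).$$ In particular, if $\beta_{(2)}^n(G)\ne0$ then $[p_n]\neq0$ in $K_0(C^*_r(G))$.
   Context: A group $G$ is of type $F_{m}$ if it admits an Eilenberg-MacLane space $K(G,1)$ with finite $m$-skeleton. Fix a model $X$ of $K(G,1)$ with finite $(n+1)$-skeleton and let $k_i$ be the number of $i$-simplices (cells) of $X$, $i\le n+1$. For a unitary representation $\pi$ of $G$ on a Hilbert space $\mathcal{H}$ let $C^i(G,\pi)$ be the space of functions from the set of $i$-simplices of $X$ to $\mathcal{H}$, so $C^i(G,\pi)\simeq\mathcal{H}^{k_i}$. The element $d_i\in\mathbb{M}_{k_{i+1}\times k_i}(\mathbb{R}G)$ is the matrix representing the codifferential: for every unitary $\pi$, applying $\pi$ entrywise gives the codifferential $\pi(d_i):C^i(G,\pi)\to C^{i+1}(G,\pi)$ of the cochain complex computing $H^*(G,\pi)$ (the cellular cochain complex $\mathrm{Hom}_G(C_*(\widetilde X),\mathcal{H})$ of the universal cover, written with respect to chosen lifts of the simplices); $d_{-1}=0$. With the involution on matrices over $\mathbb{R}G$ given by transposition combined with $g\mapsto g^{-1}$, the cohomological Laplacian is $\Delta_n=d_n^*d_n+d_{n-1}d_{n-1}^*\in\mathbb{M}_{k_n}(\mathbb{R}G)\subseteq\mathbb{M}_{k_n}(C^*_r(G))$,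 where $C^*_r(G)$ is the reduced group $C^*$-algebra, the completion of $\mathbb{C}G$ in the left regular representation $\lambda$ on $\ell_2(G)$. The Kazhdan projection in degree $n$ over $C^*_r(G)$ is the projection $p_n=p_n^*=p_n^2\in\mathbb{M}_{k_n}(C^*_r(G))$ such that $\lambda(p_n)$ is the orthogonal projection $C^n(G,\lambda)\to\ker\lambda(\Delta_n)$; it exists in $\mathbb{M}_{k_n}(C^*_r(G))$ when $\Delta_n$ has a spectral gap there. The canonical trace on $C^*_r(G)$ is $\tau_G(\alpha)=\langle\alpha\delta_e,\delta_e\rangle$; on $\mathbb{M}_k(C^*_r(G))$ put $\tau_{k,G}((a_{ij}))=\sum_{i=1}^k\tau_G(a_{ii})$; and $\tau_*:K_0(C^*_r(G))\to\mathbb{R}$ is the induced map, $\tau_*([p])=\tau_{k,G}(p)$ for a projection $p\in\mathbb{M}_k(C^*_r(G))$. $\beta_{(2)}^n(G)$ is the $n$-th $\ell_2$-Betti number, i.e. the von Neumann dimension over $L(G)$ of $\ker\lambda(\Delta_n)$. *)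

(* Defs.v *)
From HB Require Import structures.
From mathcomp Require Import all_boot all_order all_algebra finmap.
From mathcomp Require Import all_classical all_reals all_analysis.
From mathcomp Require Import complex ring_quotient.
From mathcomp Require monalg.
Import -(notations) monalg.
From mathcomp Require Import ring lra.

Import Order.TTheory GRing.Theory Num.Theory.
Import numFieldNormedType.Exports.

Set Implicit Arguments.
Unset Strict Implicit.
Unset Printing Implicit Defensive.

Local Open Scope classical_set_scope.
Local Open Scope ring_scope.

(* {malg K[T]} is the free K-module on T. Its library file is imported without
   notations, which are incompatible with those of the analysis library. *)
Local Notation "{ 'malg' G [ K ] }" := (@monalg.malg K G) : type_scope.

(* The library's product on {malg K[T]} requires a monoid T without nontrivial
   units, hence this separate construction for groups. *)
Section GroupRing.
Variables (K : nzRingType) (G : groupType).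

Definition gring : Type := {malg K[G]}.

HB.instance Definition _ := GRing.Lmodule.on gring.

Definition gmul (a b : gring) : gring :=
  \sum_(g <- msupp a) \sum_(h <- msupp b) mkmalgU (g * h)%g (mcoeff g a * mcoeff h b).

Lemma gmulEw (A B : {fset G}) (a b : gring) :
  (msupp a `<=` A)%fset -> (msupp b `<=` B)%fset ->
  gmul a b = \sum_(g <- A) \sum_(h <- B)
    mkmalgU (g * h)%g (mcoeff g a * mcoeff h b).
Proof.
move=> aA bB; rewrite /gmul (big_fset_incl _ aA) /=.
  apply/eq_bigr=> g _; apply/big_fset_incl => // h _ /mcoeff_outdom ->.
  by rewrite mulr0 monalgU0.
move=> g _ /mcoeff_outdom ag; rewrite big1 // => h _.
by rewrite ag mul0r monalgU0.
Qed.

Lemma gmulUU (g h : G) (x y : K) :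
  gmul (mkmalgU g x) (mkmalgU h y) = mkmalgU (g * h)%g (x * y).
Proof.
by rewrite (gmulEw msuppU_le msuppU_le) !big_seq_fset1 !mcoeffUU.
Qed.

Lemma gmulDl : left_distributive gmul +%R.
Proof.
move=> a b c.
have sab := msuppD_le a b; have sc := fsubset_refl (msupp c).
rewrite (gmulEw sab sc) (gmulEw (fsubsetUl _ (msupp b)) sc).
rewrite (gmulEw (fsubsetUr (msupp a) _) sc) -big_split; apply/eq_bigr=> g _ /=.
by rewrite -big_split; apply/eq_bigr=> h _; rewrite mcoeffD mulrDl monalgUD.
Qed.

Lemma gmulDr : right_distributive gmul +%R.
Proof.
move=> c a b.
have sab := msuppD_le a b; have sc := fsubset_refl (msupp c).
rewrite (gmulEw sc sab) (gmulEw sc (fsubsetUl _ (msupp b))).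
rewrite (gmulEw sc (fsubsetUr (msupp a) _)) -big_split; apply/eq_bigr=> g _ /=.
by rewrite -big_split; apply/eq_bigr=> h _; rewrite mcoeffD mulrDr monalgUD.
Qed.

Lemma gmul0 : left_zero 0 gmul.
Proof. by move=> a; rewrite /gmul msupp0 big_seq_fset0. Qed.

Lemma gmulr0 : right_zero 0 gmul.
Proof.
by move=> a; rewrite /gmul big1 // => g _; rewrite msupp0 big_seq_fset0.
Qed.

Lemma gmul_suml (I : Type) (r : seq I) (F : I -> gring) b :
  gmul (\sum_(i <- r) F i) b = \sum_(i <- r) gmul (F i) b.
Proof. exact: (big_morph (gmul^~ b) (fun x y => gmulDl x y b) (gmul0 b)). Qed.

Lemma gmul_sumr (I : Type) (r : seq I) (F : I -> gring) b :
  gmul b (\sum_(i <- r) F i) = \sum_(i <- r) gmul b (F i).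
Proof. exact: (big_morph (gmul b) (gmulDr b) (gmulr0 b)). Qed.

Lemma gmulA : associative gmul.
Proof.
move=> a b c; rewrite (monalgE a); set S := bigop _ _ _.
rewrite [gmul S (gmul b c)]gmul_suml [gmul S b]gmul_suml gmul_suml.
apply/eq_bigr=> g _; rewrite (monalgE b) {S}; set S := bigop _ _ _.
rewrite [gmul S c]gmul_suml [gmul _ S]gmul_sumr gmul_sumr gmul_suml.
apply/eq_bigr=> h _; rewrite (monalgE c) {S}; set S := bigop _ _ _.
rewrite [gmul _ S]gmul_sumr [in RHS]gmul_sumr gmul_sumr; apply/eq_bigr=> k _.
by rewrite !gmulUU mulrA mulgA.
Qed.

Lemma gmul1l : left_id (mkmalgU 1%g 1) gmul.
Proof.
move=> a; rewrite {1}(monalgE a) gmul_sumr [RHS]monalgE.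
by apply/eq_bigr=> g _; rewrite gmulUU mul1r mul1g.
Qed.

Lemma gmul1r : right_id (mkmalgU 1%g 1) gmul.
Proof.
move=> a; rewrite {1}(monalgE a) gmul_suml [RHS]monalgE.
by apply/eq_bigr=> g _; rewrite gmulUU mulr1 mulg1.
Qed.

Lemma gone_neq0 : mkmalgU 1%g 1 != 0 :> gring.
Proof. by rewrite monalgU_eq0 oner_eq0. Qed.

HB.instance Definition _ := GRing.Zmodule_isNzRing.Build gring
  gmulA gmul1l gmul1r gmulDl gmulDr gone_neq0.

(* No conjugation of the coefficients: only used for K real. *)
Definition gstar (a : gring) : gring :=
  \sum_(g <- msupp a) mkmalgU (g^-1)%g (mcoeff g a).

End GroupRing.

Definition gmap (K L : nzRingType) (G : groupType) (f : K -> L)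
    (a : gring K G) : gring L G :=
  \sum_(g <- msupp a) mkmalgU g (f (mcoeff g a)).

Section EllTwo.
Variables (R : realType) (G : groupType).
Local Notation C := R[i].

Definition sqmod (z : C) : R := complex.Re z ^+ 2 + complex.Im z ^+ 2.

Definition sqsum (x : G -> C) : \bar R :=
  (\esum_(g in [set: G]) (sqmod (x g))%:E)%E.

Definition sqsummable (x : G -> C) : bool := `[< (sqsum x < +oo)%E >].

Record l2 : Type := L2 { l2val :> G -> C; _ : sqsummable l2val }.

HB.instance Definition _ := [isSub for l2val].
HB.instance Definition _ := [Choice of l2 by <:].

Lemma sqmod_ge0 z : 0 <= sqmod z.
Proof. by rewrite addr_ge0 ?sqr_ge0. Qed.

Lemma sqmodD z w : sqmod (z + w) <= sqmod z + sqmod z + (sqmod w + sqmod w).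
Proof. by case: z w => [a b] [c d]; rewrite /sqmod /=; have := sqr_ge0 (a - c); have := sqr_ge0 (b - d); nra. Qed.

Lemma sqmodM z w : sqmod (z * w) = sqmod z * sqmod w.
Proof. by case: z w => [a b] [c d]; rewrite /sqmod /=; ring. Qed.

Lemma sqsum_ge0 x : (0 <= sqsum x)%E.
Proof. by apply: esum_ge0 => g _; rewrite lee_fin sqmod_ge0. Qed.


Lemma sqsumD (x y : G -> C) :
  (sqsum (x + y)%R <= sqsum x + sqsum x + (sqsum y + sqsum y))%E.
Proof.
rewrite /sqsum -!esumD; try by move=> *; rewrite ?adde_ge0 ?lee_fin ?sqmod_ge0.
apply: le_esum => g _; rewrite -!EFinD lee_fin; exact: sqmodD.
Qed.

Lemma sqsumZ (a : C) (x : G -> C) :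
  (sqsum (a *: x)%R <= (sqmod a)%:E * sqsum x)%E.
Proof.
apply: ge_ereal_sup => _ [A [finA _] <-].
under eq_fsbigr do rewrite [sqmod _]sqmodM EFinM.
rewrite -ge0_mule_fsumr; last by move=> g; rewrite lee_fin sqmod_ge0.
rewrite lee_wpmul2l ?lee_fin ?sqmod_ge0 //.
by apply: ereal_sup_ubound; exists A.
Qed.

Lemma sqsum0 : sqsum 0 = 0%E.
Proof. by apply: esum1 => g _; rewrite /sqmod /= expr0n addr0. Qed.

Lemma sqsummable_submod : submod_closed sqsummable.
Proof.
split; first by apply/asboolP; rewrite sqsum0 ltry.
move=> a x y /asboolP xfin /asboolP yfin; apply/asboolP.
have axfin : (sqsum (a *: x)%R < +oo)%E.
  apply: (le_lt_trans (sqsumZ a x)).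
  by rewrite lte_mul_pinfty ?lee_fin ?sqmod_ge0.
by apply: (le_lt_trans (sqsumD _ _)); rewrite !lte_add_pinfty.
Qed.

HB.instance Definition _ := GRing.isSubmodClosed.Build C (G -> C) sqsummable
  sqsummable_submod.
HB.instance Definition _ := [SubChoice_isSubLmodule of l2 by <:].

Definition hnorm (x : l2) : R := Num.sqrt (fine (sqsum x)).

Lemma hnorm_ge0 x : 0 <= hnorm x. Proof. exact: sqrtr_ge0. Qed.

Lemma hnorm_sqr x : (hnorm x ^+ 2)%:E = sqsum x.
Proof.
rewrite sqr_sqrtr ?fine_ge0 ?sqsum_ge0 // fineK // ge0_fin_numE ?sqsum_ge0 //.
exact/asboolP/(valP x).
Qed.

Lemma hnormD x y : hnorm (x + y) <= 2 * (hnorm x + hnorm y).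
Proof.
rewrite -(@ler_pXn2r _ 2) ?nnegrE ?mulr_ge0 ?addr_ge0 ?hnorm_ge0 //.
have := sqsumD x y; rewrite -[(l2val x + l2val y)%R]/(l2val (x + y)) -!hnorm_sqr.
rewrite -!EFinD lee_fin => /le_trans; apply.
move: (hnorm_ge0 x) (hnorm_ge0 y); set u := hnorm x; set v := hnorm y => u0 v0. nra.
Qed.

Lemma hnormZ a x : hnorm (a *: x) <= Num.sqrt (sqmod a) * hnorm x.
Proof.
rewrite -(@ler_pXn2r _ 2) ?nnegrE ?mulr_ge0 ?sqrtr_ge0 ?hnorm_ge0 //.
have := sqsumZ a x; rewrite -[(a *: l2val x)%R]/(l2val (a *: x)) -!hnorm_sqr.
by rewrite -EFinM lee_fin exprMn (sqr_sqrtr (sqmod_ge0 a)).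
Qed.

Lemma sqsum_shift (g : G) (x : G -> C) :
  sqsum (fun h => x (g^-1 * h)%g) = sqsum x.
Proof.
rewrite /sqsum [RHS](@reindex_esum _ _ _ setT setT (fun h => (g^-1 * h)%g)) //.
split=> [h //|h k _ _|h _]; first exact: mulgI.
by exists (g * h)%g; rewrite // mulKg.
Qed.

Lemma sqsummable_shift g (x : l2) : sqsummable (fun h => x (g^-1 * h)%g).
Proof. by case: x => x xfin; rewrite /sqsummable /= sqsum_shift. Qed.

Lemma sqsummable_delta (g : G) : sqsummable (fun h => (h == g)%:R).
Proof.
apply/asboolP; rewrite /sqsum (_ : (fun h => _) =
  fun h => if h \in [set g] then 1%E else 0%E).
  by rewrite -esum_mkcond esum_set1 ?ltry.
apply/funext => h.
have -> : (h \in [set g]) = (h == g).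
  by apply/idP/eqP => [/set_mem//|->]; exact: mem_set.
by case: eqP => _; rewrite /sqmod /= ?expr1n ?expr0n /= addr0.
Qed.

Definition delta (g : G) : l2 := L2 (sqsummable_delta g).

Definition lshift (g : G) (x : l2) : l2 := L2 (sqsummable_shift g x).

(* The left regular representation of C[G]. *)
Definition lreg (a : gring C G) (x : l2) : l2 :=
  \sum_(g <- msupp a) mcoeff g a *: lshift g x.

Lemma lshift_linear g : linear (lshift g).
Proof. by move=> a x y; apply/val_inj/funext => h. Qed.

Lemma lreg_linear a : linear (lreg a).
Proof.
move=> c x y; rewrite /lreg scaler_sumr -big_split; apply: eq_bigr => g _ /=.
by rewrite lshift_linear scalerDr !scalerA mulrC.
Qed.

Lemma lregEw (A : {fset G}) a x : (msupp a `<=` A)%fset ->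
  lreg a x = \sum_(g <- A) mcoeff g a *: lshift g x.
Proof.
move=> aA; apply: big_fset_incl => // g _ /mcoeff_outdom ->.
exact: scale0r.
Qed.

Lemma lregU g c x : lreg (mkmalgU g c) x = c *: lshift g x.
Proof. by rewrite (lregEw _ msuppU_le) big_seq_fset1 mcoeffUU. Qed.

Lemma lregD a b x : lreg (a + b) x = lreg a x + lreg b x.
Proof.
rewrite (lregEw _ (msuppD_le a b)) (lregEw _ (fsubsetUl _ (msupp b))).
rewrite (lregEw _ (fsubsetUr (msupp a) _)) -big_split.
by apply: eq_bigr => g _; rewrite mcoeffD scalerDl.
Qed.

Lemma lreg0 x : lreg 0 x = 0.
Proof. by rewrite /lreg msupp0 big_seq_fset0. Qed.

Lemma lregZ c a x : lreg (c *: a) x = c *: lreg a x.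
Proof.
rewrite (lregEw _ (msuppZ_le c a)) /lreg scaler_sumr.
by apply: eq_bigr => g _; rewrite mcoeffZ scalerA.
Qed.

Lemma lreg_sum (I : Type) (r : seq I) (F : I -> gring C G) x :
  lreg (\sum_(i <- r) F i) x = \sum_(i <- r) lreg (F i) x.
Proof. exact: (big_morph (lreg^~ x) (fun a b => lregD a b x) (lreg0 x)). Qed.

Lemma lshift_sum (I : Type) (r : seq I) g (F : I -> l2) :
  lshift g (\sum_(i <- r) F i) = \sum_(i <- r) lshift g (F i).
Proof.
pose f := HB.pack_for {linear l2 -> l2} (lshift g)
  (GRing.isLinear.Build _ _ _ _ (lshift g) (lshift_linear g)).
exact: (raddf_sum f).
Qed.

Lemma lshiftM g h x : lshift (g * h)%g x = lshift g (lshift h x).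
Proof. by apply/val_inj/funext => k /=; rewrite invgM mulgA. Qed.

Lemma lshift1 x : lshift 1%g x = x.
Proof. by apply/val_inj/funext => k /=; rewrite invg1 mul1g. Qed.

Lemma lreg1 x : lreg 1 x = x.
Proof. by rewrite [1]/(mkmalgU 1%g 1) lregU scale1r lshift1. Qed.

Lemma lshiftZ g c x : lshift g (c *: x) = c *: lshift g x.
Proof. by apply/val_inj/funext. Qed.

Lemma lregM a b x : lreg (a * b) x = lreg a (lreg b x).
Proof.
rewrite [a * b]/(gmul a b) /gmul lreg_sum.
rewrite /(lreg a); apply: eq_bigr => g _.
rewrite lreg_sum lshift_sum scaler_sumr; apply: eq_bigr => h _.
by rewrite lregU lshiftM lshiftZ scalerA.
Qed.

Lemma hnorm_lshift g x : hnorm (lshift g x) = hnorm x.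
Proof. by rewrite /hnorm sqsum_shift. Qed.

Lemma lreg_bounded a : exists2 M, 0 <= M & forall x, hnorm (lreg a x) <= M * hnorm x.
Proof.
rewrite /lreg; elim: (enum_fset (msupp a)) => [|g s [M M0 IH]].
  exists 0 => // x; rewrite big_nil mul0r /hnorm.
  by rewrite [X in sqsum X](_ : _ = 0) ?sqsum0 ?sqrtr0.
exists (2 * (Num.sqrt (sqmod (mcoeff g a)) + M)).
  by rewrite mulr_ge0 ?addr_ge0 ?sqrtr_ge0.
move=> x; rewrite big_cons (le_trans (hnormD _ _)) // -mulrA ler_pM2l // mulrDl.
by rewrite lerD // (le_trans (hnormZ _ _)) ?hnorm_lshift.
Qed.
End EllTwo.

Lemma scale_le (R : realType) (e K z y : R) : 0 <= e -> 0 <= K -> 0 <= z ->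
  y <= e / (4 * (K + 1)) * z -> K * y <= e / 4 * z.
Proof.
move=> e0 K0 z0 yz; apply: (le_trans (ler_wpM2l K0 yz)); rewrite mulrA.
rewrite ler_wpM2r // -subr_ge0.
have -> : e / 4 - K * (e / (4 * (K + 1))) = e / (4 * (K + 1)) by field; lra.
by rewrite divr_ge0 ?mulr_ge0 //; lra.
Qed.

Section ReducedCstar.
Variables (R : realType) (G : groupType).
Local Notation C := R[i].
Local Notation H := (l2 R G).

(* Membership in the closure of lreg (C[G]) for the operator norm. *)
Definition in_cstar (T : H -> H) : bool :=
  `[< linear T /\ forall e : R, 0 < e ->
      exists a : gring C G, forall x, hnorm (T x - lreg a x) <= e * hnorm x >].

(* The reduced C*-algebra of G, as an algebra of operators on l2(G). *)
Record cstar : Type := Cstar { cstar_fun :> H -> H; _ : in_cstar cstar_fun }.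

HB.instance Definition _ := [isSub for cstar_fun].
HB.instance Definition _ := [Choice of cstar by <:].

Lemma in_cstar_submod : submod_closed in_cstar.
Proof.
split.
  apply/asboolP; split; first by move=> c x y /=; rewrite scaler0 addr0.
  move=> e e0; exists 0 => x; rewrite lreg0 subr0.
  suff -> : hnorm (0 : H) = 0 by rewrite mulr_ge0 ?hnorm_ge0 // ltW.
  by rewrite /hnorm [X in sqsum X](_ : _ = 0) ?sqsum0 ?sqrtr0.
move=> c S T /asboolP [Slin Sapp] /asboolP [Tlin Tapp]; apply/asboolP; split.
  move=> z x y; rewrite ![(c *: S + T) _]/(c *: S _ + T _) Slin Tlin.
  by rewrite !scalerDr !scalerA [z * c]mulrC addrACA.
move=> e e0; set s := Num.sqrt (sqmod c).
have s0 : 0 <= s by rewrite sqrtr_ge0.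
have [a ha] := Sapp (e / (4 * (s + 1))) ltac:(by rewrite divr_gt0 ?mulr_gt0 //; lra).
have [b hb] := Tapp (e / 4) ltac:(lra).
exists (c *: a + b) => x; rewrite [(c *: S + T) _]/(c *: S _ + T _).
rewrite lregD lregZ opprD addrACA -scalerBr (le_trans (hnormD _ _)) //.
have n0 := hnorm_ge0 x; have := hb x.
have : s * hnorm (S x - lreg a x) <= e / 4 * hnorm x.
  exact: scale_le (ltW e0) s0 n0 (ha x).
have := hnormZ c (S x - lreg a x); rewrite -/s; lra.
Qed.

HB.instance Definition _ := GRing.isSubmodClosed.Build C (H -> H) in_cstar
  in_cstar_submod.
HB.instance Definition _ := [SubChoice_isSubLmodule of cstar by <:].

Lemma cstar_linear (T : cstar) : linear T.
Proof. by have /asboolP [] := valP T. Qed.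

Lemma cstar_approx (T : cstar) (e : R) : 0 < e ->
  exists a : gring C G, forall x, hnorm (T x - lreg a x) <= e * hnorm x.
Proof. by have /asboolP [_] := valP T; apply. Qed.

Lemma cstar_bounded (T : cstar) :
  exists2 M, 0 <= M & forall x, hnorm (T x) <= M * hnorm x.
Proof.
have [a ha] := cstar_approx T ltr01; have [M M0 hM] := lreg_bounded a.
exists (2 * (1 + M)); first by lra.
move=> x; rewrite -[T x](subrK (lreg a x)) (le_trans (hnormD _ _)) //.
by have := ha x; have := hM x; lra.
Qed.

Lemma cstarD (T : cstar) x y : T (x + y) = T x + T y.
Proof. by have := cstar_linear T 1 x y; rewrite !scale1r. Qed.

Lemma in_cstar_comp (S T : cstar) : in_cstar (S \o T).
Proof.
apply/asboolP; split; first by move=> c x y /=; rewrite !cstar_linear.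
move=> e e0; have [M M0 hM] := cstar_bounded S.
have [b hb] := @cstar_approx T (e / (4 * (M + 1)))
  ltac:(by rewrite divr_gt0 ?mulr_gt0 //; lra).
have [N N0 hN] := lreg_bounded b.
have [a ha] := @cstar_approx S (e / (4 * (N + 1)))
  ltac:(by rewrite divr_gt0 ?mulr_gt0 //; lra).
exists (a * b) => x; rewrite /= lregM.
have -> : S (T x) - lreg a (lreg b x) =
    S (T x - lreg b x) + (S (lreg b x) - lreg a (lreg b x)).
  by rewrite addrA -cstarD subrK.
rewrite (le_trans (hnormD _ _)) //; have n0 := hnorm_ge0 x.
have := scale_le (ltW e0) M0 n0 (hb x); have := hM (T x - lreg b x).
have : hnorm (S (lreg b x) - lreg a (lreg b x)) <= e / 4 * hnorm x.
  apply: (le_trans (ha _)).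
  have q0 : 0 <= e / (4 * (N + 1)) by rewrite divr_ge0 ?mulr_ge0 //; lra.
  apply: (le_trans (ler_wpM2l q0 (hN x))); rewrite mulrCA.
  exact: scale_le (ltW e0) N0 n0 (lexx _).
lra.
Qed.

Lemma in_cstar_lreg (a : gring C G) : in_cstar (lreg a).
Proof.
apply/asboolP; split; first exact: lreg_linear.
move=> e e0; exists a => x; rewrite subrr /hnorm [X in sqsum X](_ : _ = 0) //.
by rewrite sqsum0 sqrtr0 mulr_ge0 ?hnorm_ge0 // ltW.
Qed.

Definition lambda (a : gring C G) : cstar := Cstar (in_cstar_lreg a).

Definition cmul (S T : cstar) : cstar := Cstar (in_cstar_comp S T).

Lemma cstar_eqP (S T : cstar) : S =1 T -> S = T.
Proof. by move=> /funext ST; apply: val_inj. Qed.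

Lemma cmulA : associative cmul. Proof. by move=> S T U; exact: cstar_eqP. Qed.

Lemma cmul1l : left_id (lambda 1) cmul.
Proof. by move=> T; apply: cstar_eqP => x /=; rewrite lreg1. Qed.

Lemma cmul1r : right_id (lambda 1) cmul.
Proof. by move=> T; apply: cstar_eqP => x /=; rewrite lreg1. Qed.

Lemma cmulDl : left_distributive cmul +%R.
Proof. by move=> S T U; exact: cstar_eqP. Qed.

Lemma cmulDr : right_distributive cmul +%R.
Proof. by move=> S T U; apply: cstar_eqP => x; exact: cstarD. Qed.

Lemma cone_neq0 : lambda 1 != 0.
Proof.
apply/eqP => /(congr1 (fun T : cstar => T (delta R 1%g) 1%g)) /eqP.
by rewrite /= lreg1 /= eqxx oner_eq0.
Qed.

HB.instance Definition _ := GRing.Zmodule_isNzRing.Build cstar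
  cmulA cmul1l cmul1r cmulDl cmulDr cone_neq0.

Lemma cscalerAl (c : C) (S T : cstar) : c *: (S * T) = c *: S * T.
Proof. exact: cstar_eqP. Qed.

HB.instance Definition _ := GRing.Lmodule_isLalgebra.Build C cstar cscalerAl.

Lemma cscalerAr (c : C) (S T : cstar) : c *: (S * T) = S * (c *: T).
Proof.
have S0 : S 0 = 0 by apply: (addrI (S 0)); rewrite -cstarD !addr0.
apply: cstar_eqP => x; have := cstar_linear S c (T x) 0.
by rewrite S0 !addr0 => /= ->.
Qed.

HB.instance Definition _ := GRing.Lalgebra_isAlgebra.Build C cstar cscalerAr.
End ReducedCstar.

Section Hilbert.
Variables (R : realType) (G : groupType).
Local Notation C := R[i].
Local Notation H := (l2 R G).

(* The unordered sum of an absolutely summable family. *)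
Definition rsum (f : G -> R) : R :=
  fine (\esum_(g in [set: G]) (Num.max (f g) 0)%:E) -
  fine (\esum_(g in [set: G]) (Num.max (- f g) 0)%:E).

Definition inner (x y : H) : C :=
  Complex (rsum (fun g => complex.Re (x g * conjc (y g))))
          (rsum (fun g => complex.Im (x g * conjc (y g)))).

(* The Hilbert space adjoint of T: it is unique, and it exists in cstar because
   lreg (C[G]) is closed under adjoints and taking adjoints is isometric. *)
Definition cadj (T : cstar R G) : cstar R G :=
  xget 0 [set S : cstar R G | forall x y, inner (T x) y = inner x (S y)].

Definition tau (T : cstar R G) : C := inner (T (delta R 1%g)) (delta R 1%g).

Definition inner_pow k (x y : 'I_k -> H) : C := \sum_i inner (x i) (y i).

Definition mxact m k (M : 'M[cstar R G]_(m, k)) (x : 'I_k -> H) : 'I_m -> H :=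
  fun i => \sum_j M i j (x j).

Definition is_orthproj k (V : set ('I_k -> H)) (x y : 'I_k -> H) : Prop :=
  V y /\ forall v, V v -> inner_pow (x - y) v = 0.

(* The orthogonal projection onto V, which exists for every closed subspace V. *)
Definition orthproj k (V : set ('I_k -> H)) (x : 'I_k -> H) : 'I_k -> H :=
  xget 0 (is_orthproj V x).

Definition basis_vec k (i : 'I_k) : 'I_k -> H :=
  fun j => if j == i then delta R 1%g else 0.

(* The von Neumann dimension over L(G) of a closed subspace V of l2(G)^k invariant
   under right translations: the trace (tau summed over the diagonal) of the
   orthogonal projection onto V. This trace is a nonnegative real number. *)
Definition vn_dim k (V : set ('I_k -> H)) : R :=
  complex.Re (\sum_i inner_pow (orthproj V (basis_vec i)) (basis_vec i)).
End Hilbert.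

Section Ktheory.
Variables (A : nzRingType) (star : A -> A).

Definition adjmx m n (M : 'M[A]_(m, n)) : 'M[A]_(n, m) := (map_mx star M)^T.

Definition is_projection n (p : 'M[A]_n) : Prop :=
  adjmx p = p /\ p *m p = p.

Record projection : Type := Projection {
  pdim : nat;
  pmx : 'M[A]_pdim;
  projectionP : is_projection pmx
}.

HB.instance Definition _ := gen_eqMixin projection.
HB.instance Definition _ := gen_choiceMixin projection.

(* Murray-von Neumann equivalence, between matrices of possibly different sizes. *)
Definition mvn_equiv (p q : projection) : Prop :=
  exists v : 'M[A]_(pdim q, pdim p),
    adjmx v *m v = pmx p /\ v *m adjmx v = pmx q.

Definition pgen (p : projection) : {malg int[projection]} := mkmalgU p 1.

(* For a unital C*-algebra A, K0 A is the Grothendieck group of the monoid of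
   equivalence classes of projections over A under the block diagonal sum, given
   here by generators (the projections) and relations. *)
Inductive K0_relation : {malg int[projection]} -> Prop :=
| K0_mvn p q of mvn_equiv p q : K0_relation (pgen p - pgen q)
| K0_sum p q (pq : is_projection (block_mx (pmx p) 0 0 (pmx q))) :
    K0_relation (pgen (Projection pq) - (pgen p + pgen q)).

(* The subgroup generated by the relations. *)
Definition K0_null (x : {malg int[projection]}) : bool :=
  `[< forall S : set {malg int[projection]},
        S 0 -> (forall y z, S y -> S z -> S (y - z)) ->
        (forall y, K0_relation y -> S y) -> S x >].

Lemma K0_null_zmod : zmod_closed K0_null.
Proof.
split; first by rewrite unfold_in; apply/asboolP => S S0 _ _.
move=> x y; rewrite !unfold_in => /asboolP xS /asboolP yS.
apply/asboolP => S S0 SB SK.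
exact: SB _ _ (xS S S0 SB SK) (yS S S0 SB SK).
Qed.

HB.instance Definition _ := GRing.isZmodClosed.Build _ K0_null
  K0_null_zmod.

Definition K0 : Type :=
  Quotient.quot (GRing.ZmodClosed.clone _ K0_null _).

HB.instance Definition _ := GRing.Zmodule.on K0.
HB.instance Definition _ := EqQuotient.on K0.

Definition K0_class n (p : 'M[A]_n) (pP : is_projection p) : K0 :=
  (\pi_K0 (pgen (Projection pP)))%qT.
End Ktheory.

Section Trace.
Variables (R : realType) (G : groupType).

Definition tau_mx k (M : 'M[cstar R G]_k) : R[i] := \sum_i tau (M i i).

(* The map induced by tau_mx on K0: the Z-linear extension of tau_mx, evaluated at
   a representative of x in the free group on the projections. Being tracial, tau_mx
   respects the relations, so that the choice of representative is irrelevant; its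
   values at projections are real. *)
Definition tau_star (x : K0 (@cadj R G)) : R :=
  let c := repr x in
  \sum_(p <- msupp c) complex.Re (tau_mx (pmx p)) *~ mcoeff p c.

Definition spectrum k (M : 'M[cstar R G]_k) : set R[i] :=
  [set z | ~ exists N : 'M[cstar R G]_k,
     (z%:A%:M - M) *m N = 1%:M /\ N *m (z%:A%:M - M) = 1%:M].

Definition spectral_gap k (M : 'M[cstar R G]_k) : Prop :=
  exists2 e : R, 0 < e &
    forall z, spectrum M z -> z = 0 \/ exists2 t : R, e <= t & z = (t%:C)%C.

Definition ker_mx k (M : 'M[cstar R G]_k) : set ('I_k -> l2 R G) :=
  [set x | mxact M x = 0].

Record is_kazhdan_projection k (L p : 'M[cstar R G]_k) : Prop := {
  kazhdan_is_projection : is_projection (@cadj R G) p;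
  kazhdan_onto_kernel : forall x, is_orthproj (ker_mx L) x (mxact p x)
}.

(* The case n = 0 uses the convention d_(-1) = 0. *)
Definition laplacian (k : nat -> nat)
    (d : forall i, 'M[gring R G]_(k i.+1, k i)) (n : nat) : 'M[gring R G]_(k n) :=
  adjmx (@gstar R G) (d n) *m d n +
  match n with
  | 0 => 0
  | m.+1 => d m *m adjmx (@gstar R G) (d m)
  end.

Definition lambdaR (a : gring R G) : cstar R G := lambda (gmap (real_complex R) a).

End Trace.

Section Betti.
Variables (R : realType) (G : groupType) (k : nat -> nat).
Variables (d : forall i, 'M[gring R G]_(k i.+1, k i)) (n : nat).

Definition cstar_laplacian : 'M[cstar R G]_(k n) :=
  map_mx (@lambdaR R G) (laplacian d n).

Definition l2_betti : R := vn_dim (ker_mx cstar_laplacian).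
End Betti.

Section Singular.
Variables (R : realType).

Definition simplex_set n : set 'rV[R]_n.+1 :=
  [set x | (forall i, 0 <= x 0 i) /\ \sum_i x 0 i = 1].

Definition simplex n : topologicalType := set_type (@simplex_set n).

Definition simplex_interior n : set (simplex n) :=
  [set x | forall i, 0 < (\val x : 'rV[R]_n.+1) 0 i].

Definition face_row n (j : 'I_n.+2) (x : 'rV[R]_n.+1) : 'rV[R]_n.+2 :=
  \row_i oapp (x 0) 0 (unlift j i).

Lemma face_row_subproof n (j : 'I_n.+2) (x : simplex n) :
  face_row j (\val x) \in @simplex_set n.+1.
Proof.
have /set_mem [x0 x1] := valP x; apply/mem_set; split.
  by move=> i; rewrite mxE; case: unliftP => [k|] //= _; exact: x0.
rewrite (bigD1_ord j) //= mxE unlift_none add0r -[RHS]x1.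
by apply: eq_bigr => i _; rewrite mxE liftK.
Qed.

Definition face n (j : 'I_n.+2) (x : simplex n) : simplex n.+1 :=
  exist _ (face_row j (\val x)) (face_row_subproof j x).

Variable Y : topologicalType.

Definition singular_chain n (A : set Y) : set {malg int[simplex n -> Y]} :=
  [set c | forall s, s \in msupp c -> continuous s /\ range s `<=` A].

Definition sing_boundary n (c : {malg int[simplex n.+1 -> Y]}) :
    {malg int[simplex n -> Y]} :=
  \sum_(s <- msupp c) \sum_(j < n.+2)
    mkmalgU (s \o face j) ((-1) ^+ j * mcoeff s c).
End Singular.

Section CWComplex.
Variables (R : realType).

(* CW structures in the sense of Whitehead. The characteristic maps are defined on
   the standard simplex instead of the homeomorphic ball, so that each of them is a
   singular simplex, representing a generator of the relative homology of its cell. *)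
Record CW_structure (X : topologicalType) : Type := CWStructure {
  cell : nat -> Type;
  char_map : forall n, cell n -> simplex R n -> X;
  open_cell n (e : cell n) : set X := char_map e @` @simplex_interior R n;
  CW_hausdorff : hausdorff_space X;
  CW_continuous : forall n (e : cell n), continuous (char_map e);
  CW_injective : forall n (e : cell n), set_inj (@simplex_interior R n) (char_map e);
  CW_embedding : forall n (e : cell n) (U : set (simplex R n)), open U ->
    exists2 V : set X, open V &
      char_map e @` (U `&` @simplex_interior R n) = V `&` open_cell e;
  CW_disjoint : forall n m (e : cell n) (f : cell m),
    open_cell e `&` open_cell f !=set0 -> existT cell n e = existT cell m f;
  CW_cover : forall x, exists n (e : cell n), open_cell e x;
  CW_closure_finite : forall n (e : cell n),
    exists2 F : set {m & cell m}, finite_set F /\ (forall f, F f -> (tag f < n)%N) &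
      char_map e @` (~` @simplex_interior R n) `<=` \bigcup_(f in F) open_cell (tagged f);
  CW_weak_topology : forall A : set X,
    (forall n (e : cell n), closed (A `&` range (char_map e))) -> closed A
}.

Definition homeo_on (Y X : topologicalType) (f : Y -> X) (V : set Y) (U : set X) :=
  [/\ {within V, continuous f}, set_bij V U f &
      forall W, open W -> W `<=` V -> open (f @` W)].

Definition covering_map (Y X : topologicalType) (p : Y -> X) : Prop :=
  [/\ continuous p, set_surj setT setT p &
      forall x, exists2 U : set X, open U /\ U x &
        exists (I : Type) (V : I -> set Y),
          [/\ trivIset setT V, p @^-1` U = \bigcup_i V i &
              forall i, open (V i) /\ homeo_on p (V i) U]].

Definition contractible (Y : topologicalType) : Prop :=
  exists (y0 : Y) (h : R * Y -> Y),
    [/\ {within `[0, 1] `*` setT, continuous h},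
        forall y, h (0, y) = y & forall y, h (1, y) = y0].

Definition deck_transformation (Y X : topologicalType) (p : Y -> X) (f : Y -> Y) :=
  [/\ continuous f, (exists2 f', continuous f' & cancel f f' /\ cancel f' f) &
      p \o f = p].

(* A K(G,1): a CW complex EM_base whose universal cover EM_cover is contractible,
   with G identified with the group of deck transformations, i.e. with the
   fundamental group of EM_base. *)
Record EM_space (G : groupType) : Type := EMSpace {
  EM_base : topologicalType;
  EM_CW : CW_structure EM_base;
  EM_cover : topologicalType;
  EM_proj : EM_cover -> EM_base;
  EM_covering : covering_map EM_proj;
  EM_contractible : contractible EM_cover;
  EM_act : G -> EM_cover -> EM_cover;
  EM_actM : forall g h, EM_act (g * h)%g = EM_act g \o EM_act h;
  EM_act_deck : forall g, deck_transformation EM_proj (EM_act g);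
  EM_deck_act : forall f, deck_transformation EM_proj f -> exists! g, f = EM_act g
}.

(* Enumerations of the cells of dimension at most m, witnessing that the m-skeleton
   is finite, and a choice of lifts to the universal cover. Nothing is required of
   nth_cell in dimensions greater than m (where ncell may be 0). *)
Record finite_skeleton (G : groupType) (X : EM_space G) (m : nat) : Type :=
    FiniteSkeleton {
  ncell : nat -> nat;
  nth_cell : forall i, 'I_(ncell i) -> cell (EM_CW X) i;
  nth_cell_bij : forall i, (i <= m)%N -> bijective (@nth_cell i);
  lift_cell : forall i, 'I_(ncell i) -> simplex R i -> EM_cover X;
  lift_cell_continuous : forall i a, continuous (@lift_cell i a);
  lift_cellP : forall i a, @EM_proj _ X \o @lift_cell i a = char_map (nth_cell a)
}.

Variables (G : groupType) (X : EM_space G) (m : nat) (S : finite_skeleton X m).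

(* The (i-1)-skeleton of the universal cover. *)
Definition cover_skeleton i : set (EM_cover X) :=
  [set y | exists j (e : cell (EM_CW X) j), (j < i)%N /\ open_cell e (@EM_proj _ X y)].

(* D is the matrix of the boundary map of the cellular chain complex of the universal
   cover, a complex of free Z[G]-modules with bases the chosen lifts: the boundary of
   the a-th lifted (i+1)-cell equals \sum_b D a b . (b-th lifted i-cell) in
   H_i(skeleton i, skeleton (i-1)), i.e. up to a chain u of the (i-1)-skeleton and the
   boundary of a chain w of the i-skeleton. *)
Definition is_boundary_matrix i
    (D : 'M[gring int G]_(ncell S i.+1, ncell S i)) : Prop :=
  forall a, exists u w,
    [/\ @singular_chain R (EM_cover X) i (cover_skeleton i) u,
        @singular_chain R (EM_cover X) i.+1 (cover_skeleton i.+1) w &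
        sing_boundary (mkmalgU (lift_cell a) 1) =
          \sum_b \sum_(g <- msupp (D a b))
            mkmalgU (EM_act g \o lift_cell b) (mcoeff g (D a b)) + u + sing_boundary w].

(* An equivariant cochain phi is determined by its values on the lifted cells, and the
   codifferential maps it to a |-> phi (boundary of the a-th lifted (i+1)-cell)
   = \sum_b pi (D a b) (phi b). Hence its matrix is that of the boundary map, with
   coefficients viewed in R. *)
Definition is_codifferential i
    (d : 'M[gring R G]_(ncell S i.+1, ncell S i)) : Prop :=
  exists2 D, is_boundary_matrix D & d = map_mx (gmap (intr : int -> R)) D.
End CWComplex.

(* Main.v *)
Require Import Defs.
From mathcomp Require Import all_boot all_order all_algebra.
From mathcomp Require Import all_classical all_reals all_analysis.
From mathcomp Require Import finmap complex ring_quotient.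
From mathcomp Require monalg.
Import -(notations) monalg.
From mathcomp Require Import ring lra.

(** Both sides of the identity are the sum of the diagonal values of [tau] on [p].

    On the side of the Betti number, orthogonal projections onto a subspace are
    unique ([is_orthproj_inj]), so the projection onto the kernel of the Laplacian,
    whose trace is the von Neumann dimension, acts as [p] does. Evaluating it at
    the basis vectors picks out the entries [p i i] ([vn_dim_kazhdan]).

    On the side of K-theory, [tau_star] is computed from an arbitrary
    representative in the free group on the projections, so what has to be shown is
    that the linear extension of the trace kills the relations defining K0
    ([K0_null_trace]). Block sums are immediate. For a Murray-von Neumann
    equivalence given by [v], the trace must agree on [v^* v] and [v v^*]. It is
    enough to treat one entry [T] of [v], with adjoint [S]: [tau (S * T)] and
    [tau (T * S)] are the squared norms of [T delta_1] and of [S delta_1]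
    ([tau_adjoint]). Operators in the reduced C*-algebra commute with right
    translations, so that the values of [S delta_1] are, up to conjugation, those
    of [T delta_1] at inverse elements ([adjoint_delta]), and inversion is a
    bijection of the group.

    The nonvanishing of the class follows, since [tau_star] vanishes at zero. *)

Import Order.TTheory GRing.Theory Num.Theory.

Set Implicit Arguments.
Unset Strict Implicit.
Unset Printing Implicit Defensive.

Local Open Scope ring_scope.

(** * Unordered sums of real families *)

Section UnorderedSums.
Variables (R : realType) (G : groupType).
Implicit Types (u v : G -> R).

Definition possum u : \bar R := (\esum_(g in [set: G]) (u g)%:E)%E.

Lemma possum_ge0 u : (forall g, 0 <= u g) -> (0 <= possum u)%E.
Proof. by move=> u0; apply: esum_ge0 => g _; rewrite lee_fin. Qed.

Lemma le_possum u v : (forall g, u g <= v g) -> (possum u <= possum v)%E.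
Proof. by move=> uv; apply: le_esum => g _; rewrite lee_fin. Qed.

Lemma possumD u v : (forall g, 0 <= u g) -> (forall g, 0 <= v g) ->
  possum (fun g => u g + v g) = (possum u + possum v)%E.
Proof.
move=> u0 v0; rewrite /possum -esumD; try by move=> g _; rewrite lee_fin.
by [].
Qed.

Lemma possum_single g0 u : 0 <= u g0 -> (forall g, g != g0 -> u g = 0) ->
  possum u = (u g0)%:E.
Proof.
move=> u0 supp; rewrite /possum (_ : (fun g => _) =
    fun g => if g \in [set g0]%classic then (u g)%:E else 0%E).
  by rewrite -esum_mkcond esum_set1.
apply/funext => g.
have -> : (g \in [set g0]%classic) = (g == g0).
  by apply/idP/eqP => [/set_mem//|->]; exact: mem_set.
by case: eqVneq => // /supp ->.
Qed.

Lemma pos_sub_neg (x : R) : Num.max x 0 - Num.max (- x) 0 = x.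
Proof.
case: (lerP 0 x) => [x0|/ltW x0].
  by rewrite max_r ?oppr_le0 // subr0.
by rewrite max_l ?oppr_ge0 // sub0r opprK.
Qed.

(** The value of [rsum] does not depend on the way the family is split into
    nonnegative summable parts; this is what makes it additive. *)
Lemma rsumE u v (f : G -> R) :
  (forall g, 0 <= u g) -> (forall g, 0 <= v g) ->
  (possum u < +oo)%E -> (possum v < +oo)%E ->
  (forall g, f g = u g - v g) ->
  rsum f = fine (possum u) - fine (possum v).
Proof.
move=> u0 v0 ufin vfin fE; rewrite /rsum.
set p := fun g => Num.max (f g) 0; set m := fun g => Num.max (- f g) 0.
rewrite -/(possum p) -/(possum m).
have p0 g : 0 <= p g by rewrite le_max lexx orbT.
have m0 g : 0 <= m g by rewrite le_max lexx orbT.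
have fin w : (forall g, 0 <= w g) -> (possum w < +oo)%E -> possum w \is a fin_num.
  by move=> w0 wfin; rewrite ge0_fin_numE ?possum_ge0.
have pfin : (possum p < +oo)%E.
  apply: le_lt_trans ufin; apply: le_possum => g.
  by rewrite ge_max u0 andbT fE lerBlDr lerDl.
have mfin : (possum m < +oo)%E.
  apply: le_lt_trans vfin; apply: le_possum => g.
  by rewrite ge_max v0 andbT fE opprB lerBlDr lerDl.
(* From p - m = u - v, compared as an identity of sums of nonnegative families. *)
have : (possum p + possum v = possum m + possum u)%E.
  rewrite -!possumD //; congr possum; apply/funext => g.
  by have := fE g; have := pos_sub_neg (f g); rewrite /p /m; lra.
rewrite -(fineK (fin _ p0 pfin)) -(fineK (fin _ v0 vfin)).
rewrite -(fineK (fin _ m0 mfin)) -(fineK (fin _ u0 ufin)).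
by rewrite -!EFinD => -[] ?; lra.
Qed.

Definition abs_summable (f : G -> R) := (possum (fun g => `|f g|%R) < +oo)%E.

Lemma rsumD f g : abs_summable f -> abs_summable g ->
  rsum (fun h => f h + g h) = rsum f + rsum g.
Proof.
move=> ffin gfin.
pose pos (f : G -> R) g := Num.max (f g) 0.
pose neg (f : G -> R) g := Num.max (- f g) 0.
have pos0 f' h : 0 <= pos f' h by rewrite le_max lexx orbT.
have neg0 f' h : 0 <= neg f' h by rewrite le_max lexx orbT.
have posfin f' : abs_summable f' -> (possum (pos f') < +oo)%E.
  apply: le_lt_trans; apply: le_possum => h.
  by rewrite ge_max normr_ge0 ler_norm.
have negfin f' : abs_summable f' -> (possum (neg f') < +oo)%E.
  apply: le_lt_trans; apply: le_possum => h.
  by rewrite ge_max normr_ge0 -normrN ler_norm.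
have pff := posfin f ffin; have pgf := posfin g gfin.
have nff := negfin f ffin; have ngf := negfin g gfin.
rewrite (@rsumE (fun h => pos f h + pos g h) (fun h => neg f h + neg g h)).
- rewrite !possumD // !fineD ?ge0_fin_numE ?possum_ge0 //.
  by rewrite /rsum -!/(possum _) /pos /neg; lra.
- by move=> h; rewrite addr_ge0.
- by move=> h; rewrite addr_ge0.
- by rewrite possumD // lte_add_pinfty.
- by rewrite possumD // lte_add_pinfty.
- move=> h; rewrite -{1}(pos_sub_neg (f h)) -{1}(pos_sub_neg (g h)) /pos /neg.
  by lra.
Qed.

Lemma rsumN (f : G -> R) : rsum (fun g => - f g) = - rsum f.
Proof. by rewrite /rsum opprB; under [in X in _ - X]eq_esum do rewrite opprK. Qed.

Lemma possum0 : possum (fun=> 0) = 0%E.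
Proof. exact: esum1. Qed.

Lemma rsum_ge0E u : (forall g, 0 <= u g) -> (possum u < +oo)%E ->
  rsum u = fine (possum u).
Proof.
move=> u0 ufin; rewrite (@rsumE u (fun=> 0)) ?possum0 ?subr0 //.
by move=> g; rewrite subr0.
Qed.

Lemma rsum_single g0 (f : G -> R) : (forall g, g != g0 -> f g = 0) ->
  rsum f = f g0.
Proof.
move=> supp; rewrite /rsum -!/(possum _).
rewrite !(@possum_single g0) ?le_max ?lexx ?orbT //=.
- exact: pos_sub_neg.
- by move=> g /supp ->; rewrite oppr0 maxxx.
- by move=> g /supp ->; rewrite maxxx.
Qed.

End UnorderedSums.

(** * The inner product of l2(G) *)

Section InnerProduct.
Variables (R : realType) (G : groupType).
Local Notation H := (l2 R G).
Implicit Types (x y z : H).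

Lemma sqsum_lty x : (sqsum x < +oo)%E.
Proof. exact/asboolP/(valP x). Qed.

(** Taking [f] to be the real or the imaginary part gives the two families whose
    sums make up the inner product. *)
Lemma abs_summable_mul x y (f : R[i] -> R) :
  (forall c, `|f c| <= `|complex.Re c| + `|complex.Im c|) ->
  abs_summable (fun g => f (x g * conjc (y g))).
Proof.
move=> fle; pose s (w : H) g := sqmod (w g).
have s0 w g : 0 <= s w g by exact: sqmod_ge0.
have sfin w : (possum (s w) < +oo)%E by exact: sqsum_lty.
pose b g := (s x g + s y g) + (s x g + s y g).
apply: (@le_lt_trans _ _ (possum b)).
  apply: le_possum => g; apply: (le_trans (fle _)).
  rewrite /b /s; case: (x g) (y g) => [p q] [r t]; rewrite /sqmod /=.
  have e1 := sqr_ge0 (p - r); have e2 := sqr_ge0 (q - t).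
  have e3 := sqr_ge0 (p + r); have e4 := sqr_ge0 (q + t).
  have e5 := sqr_ge0 (p - t); have e6 := sqr_ge0 (q - r).
  have e7 := sqr_ge0 (p + t); have e8 := sqr_ge0 (q + r).
  by apply: lerD; rewrite ler_norml; apply/andP; split; nra.
have sxy0 g : 0 <= s x g + s y g by rewrite addr_ge0.
rewrite /b possumD //.
by rewrite (possumD (s0 x) (s0 y)) !lte_add_pinfty.
Qed.

Lemma innerD x y z : inner (x + y) z = inner x z + inner y z.
Proof.
rewrite /inner /=; congr Complex; rewrite -rsumD.
- by congr rsum; apply/funext => g; rewrite /= mulrDl raddfD.
- by apply: (@abs_summable_mul x z (@complex.Re R)) => c; rewrite lerDl.
- by apply: (@abs_summable_mul y z (@complex.Re R)) => c; rewrite lerDl.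
- by congr rsum; apply/funext => g; rewrite /= mulrDl raddfD.
- by apply: (@abs_summable_mul x z (@complex.Im R)) => c; rewrite lerDr.
- by apply: (@abs_summable_mul y z (@complex.Im R)) => c; rewrite lerDr.
Qed.

Lemma innerN x y : inner (- x) y = - inner x y.
Proof.
rewrite /inner /=; congr Complex; rewrite -rsumN;
  by congr rsum; apply/funext => g; rewrite /= mulNr raddfN.
Qed.

Lemma innerC x y : inner y x = conjc (inner x y).
Proof.
rewrite /inner /= -rsumN; congr Complex; congr rsum; apply/funext => g;
  by case: (x g) (y g) => [p q] [r s] /=; ring.
Qed.

Lemma inner_deltar x g : inner x (delta R g) = x g.
Proof.
rewrite /inner !(@rsum_single _ _ g) /=; last first.
- by move=> h /negPf ->; rewrite conjc0 mulr0.
- by move=> h /negPf ->; rewrite conjc0 mulr0.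
by rewrite eqxx conjc1 mulr1; case: (x g).
Qed.

Lemma inner_self x : inner x x = ((fine (sqsum x))%:C)%C.
Proof.
rewrite /inner; congr Complex.
  rewrite rsum_ge0E.
  - congr (fine (possum _)); apply/funext => g.
    by case: (x g) => p q; rewrite /sqmod /=; ring.
  - by move=> g; case: (x g) => p q /=; rewrite mulrN opprK addr_ge0 // -expr2 sqr_ge0.
  - rewrite (_ : (fun g => _) = fun g => sqmod (x g)) ?sqsum_lty //.
    by apply/funext => g; case: (x g) => p q; rewrite /sqmod /=; ring.
rewrite (@rsum_single _ _ 1%g) => [|g _]; [case: (x _)|case: (x _)] => p q /=; ring.
Qed.

Lemma sqmod_le_hnorm x g : sqmod (x g) <= hnorm x ^+ 2.
Proof.
pose u h := if h == g then sqmod (x g) else 0.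
rewrite -lee_fin hnorm_sqr; have <- : possum u = (sqmod (x g))%:E.
  rewrite (@possum_single _ _ g) /u ?eqxx ?sqmod_ge0 //.
  by move=> h /negPf ->.
by apply: le_possum => h; rewrite /u; case: eqP => [->|_] //; exact: sqmod_ge0.
Qed.

Lemma sqmod_eq0 (z : R[i]) : sqmod z <= 0 -> z = 0.
Proof.
case: z => p q; rewrite /sqmod /= => pq0.
have := sqr_ge0 p; have := sqr_ge0 q => q2 p2.
have /eqP : p ^+ 2 = 0 by lra.
have /eqP : q ^+ 2 = 0 by lra.
by rewrite !sqrf_eq0 => /eqP -> /eqP ->.
Qed.

Lemma inner_self_eq0 x : complex.Re (inner x x) = 0 -> x = 0.
Proof.
rewrite inner_self /= => x0; apply/val_inj/funext => g; apply: sqmod_eq0.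
apply: (le_trans (sqmod_le_hnorm x g)).
by rewrite sqr_sqrtr ?fine_ge0 ?sqsum_ge0 ?x0.
Qed.

Lemma Re_inner_self_ge0 x : 0 <= complex.Re (inner x x).
Proof. by rewrite inner_self /= fine_ge0 ?sqsum_ge0. Qed.

End InnerProduct.

(** * Uniqueness of orthogonal projections *)

Section OrthogonalProjection.
Variables (R : realType) (G : groupType) (k : nat).
Implicit Types (x y z : 'I_k -> l2 R G).

Lemma inner_powB x y z :
  inner_pow (x - y) z = inner_pow x z - inner_pow y z.
Proof.
rewrite /inner_pow -sumrB; apply: eq_bigr => i _.
by rewrite -[(x - y) i]/(x i - y i) innerD innerN.
Qed.

Lemma inner_pow_eq0 x : inner_pow x x = 0 -> x = 0.
Proof.
move=> /(congr1 (@complex.Re R)); rewrite raddf_sum /= => /psumr_eq0P x0.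
apply/funext => i; apply: inner_self_eq0; apply: x0 => // j _.
exact: Re_inner_self_ge0.
Qed.

(** Two candidates differ by a vector of [V] that is orthogonal to [V], hence to
    itself. *)
Lemma is_orthproj_inj (V : set ('I_k -> l2 R G)) x y z :
  (forall u v, V u -> V v -> V (u - v)) ->
  is_orthproj V x y -> is_orthproj V x z -> y = z.
Proof.
move=> VB [Vy xy] [Vz xz]; apply/subr0_eq/inner_pow_eq0.
have Vyz := VB _ _ Vy Vz.
have : inner_pow (y - z) (y - z) =
    inner_pow (x - z) (y - z) - inner_pow (x - y) (y - z).
  by rewrite -inner_powB opprB [x - z + _]addrC addrA subrK.
by rewrite xz // xy // subrr.
Qed.

Lemma orthprojE (V : set ('I_k -> l2 R G)) x y :
  (forall u v, V u -> V v -> V (u - v)) ->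
  is_orthproj V x y -> orthproj V x = y.
Proof. by move=> VB xy; apply: xget_unique => // z /is_orthproj_inj; exact. Qed.

Lemma cstar0 (T : cstar R G) : T 0 = 0.
Proof. by apply: (addrI (T 0)); rewrite -cstarD !addr0. Qed.

Lemma cstarN (T : cstar R G) (x : l2 R G) : T (- x) = - T x.
Proof. by apply: (addrI (T x)); rewrite -cstarD !subrr cstar0. Qed.

Lemma ker_mxB (M : 'M[cstar R G]_k) x y :
  ker_mx M x -> ker_mx M y -> ker_mx M (x - y).
Proof.
move=> Mx My; rewrite /ker_mx /=.
have -> : mxact M (x - y) = mxact M x - mxact M y.
  apply/funext => i; rewrite -[RHS]/(mxact M x i - mxact M y i) /mxact -sumrB.
  by apply: eq_bigr => j _; rewrite -[(x - y) j]/(x j - y j) cstarD cstarN.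
by rewrite Mx My subrr.
Qed.

End OrthogonalProjection.

(** * The trace *)

Section Trace.
Variables (R : realType) (G : groupType).
Implicit Types (S T : cstar R G).

Lemma tauE T : tau T = T (delta R 1%g) 1%g.
Proof. exact: inner_deltar. Qed.

Lemma tau_sum (I : Type) (r : seq I) (F : I -> cstar R G) :
  tau (\sum_(i <- r) F i) = \sum_(i <- r) tau (F i).
Proof.
elim: r => [|i r IH]; first by rewrite !big_nil tauE.
by rewrite !big_cons -IH !tauE.
Qed.

(** The left regular representation commutes with right translations, and
    [delta_g] is the right translate of [delta_1]. *)
Lemma lreg_delta (a : gring R[i] G) g h :
  lreg a (delta R g) h = lreg a (delta R 1%g) (h * g^-1)%g.
Proof.
have val_sum (r : seq G) (F : G -> l2 R G) k :
    (\sum_(i <- r) F i) k = \sum_(i <- r) F i k.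
  by elim: r => [|i r IH]; rewrite ?big_nil ?big_cons //= -IH.
rewrite /lreg !val_sum; apply: eq_bigr => k _.
rewrite -![(_ *: Defs.lshift k _) _]/(_ * (_ == _)%:R); congr (_ * _%:R).
congr nat_of_bool.
by rewrite mulgA -(inj_eq (mulIg g^-1%g) (k^-1 * h)%g) mulgV.
Qed.

Lemma small_eq0 (z : R[i]) (c : R) : 0 <= c ->
  (forall e, 0 < e -> sqmod z <= e ^+ 2 * c) -> z = 0.
Proof.
move=> c0 small; apply: sqmod_eq0; rewrite leNgt; apply/negP => z0.
have q0 : 0 < sqmod z / (c + 1) by rewrite divr_gt0 // ltr_wpDl.
have := small (Num.sqrt (sqmod z / (c + 1))).
rewrite sqrtr_gt0 (sqr_sqrtr (ltW q0)) => /(_ q0).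
apply/negP; rewrite -ltNge mulrAC ltr_pdivrMr; last by rewrite ltr_wpDl.
by rewrite ltr_pM2l // ltrDl.
Qed.

(** The identity [lreg_delta] passes to norm limits, since evaluation at a point of
    [G] is a contraction. *)
Lemma cstar_delta T g h :
  T (delta R g) h = T (delta R 1%g) (h * g^-1)%g.
Proof.
apply/subr0_eq.
pose n (k : G) := hnorm (delta R k) ^+ 2.
have n0 k : 0 <= n k by exact: sqr_ge0.
apply: (@small_eq0 _ (n g + n g + (n 1%g + n 1%g))) => [|e e0].
  by rewrite !addr_ge0.
have [a aT] := cstar_approx T e0.
have near k l : sqmod (T (delta R k) l - lreg a (delta R k) l) <= e ^+ 2 * n k.
  apply: (le_trans (sqmod_le_hnorm (T (delta R k) - lreg a (delta R k)) l)).
  by rewrite -exprMn (@ler_pXn2r _ 2) ?nnegrE ?mulr_ge0 ?hnorm_ge0 ?(ltW e0) //;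
    exact: aT.
set A := T _ h; set B := T _ _.
have -> : A - B = (A - lreg a (delta R g) h) +
    - (B - lreg a (delta R 1%g) (h * g^-1)%g) by rewrite -lreg_delta; ring.
apply: (le_trans (sqmodD _ _)).
have sqmodN (z : R[i]) : sqmod (- z) = sqmod z.
  by case: z => p q; rewrite /sqmod /= !sqrrN.
rewrite sqmodN !mulrDr; have := near g h; have := near 1%g (h * g^-1)%g.
by rewrite -/A -/B; lra.
Qed.

Definition is_adjoint T S := forall x y, inner (T x) y = inner x (S y).

(** Both sides are the conjugate of the matrix coefficient of [T] at [delta_g] and
    [delta_1]. *)
Lemma adjoint_delta T S : is_adjoint T S ->
  forall g, S (delta R 1%g) g = conjc (T (delta R 1%g) g^-1%g).
Proof.
move=> TS g; rewrite -inner_deltar innerC -TS inner_deltar cstar_delta.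
by rewrite mul1g.
Qed.

(** The two sides are the squared norms of [T delta_1] and [S delta_1], sums of the
    same terms indexed by [g] and by its inverse. *)
Lemma tau_adjoint T S : is_adjoint T S -> tau (S * T) = tau (T * S).
Proof.
move=> TS; rewrite /tau; set d := delta R 1%g.
rewrite -[(S * T) d]/(S (T d)) -[(T * S) d]/(T (S d)).
rewrite TS innerC -TS !inner_self conjc_real; congr ((fine _)%:C)%C.
rewrite /sqsum [RHS](@reindex_esum _ _ _ setT setT (fun g => g^-1)%g).
  apply: eq_esum => g _; rewrite (adjoint_delta TS) invgK.
  by case: (T _ _) => p q; rewrite /sqmod /= sqrrN.
split=> // [g h _ _|g _]; first exact: invg_inj.
by exists g^-1%g; rewrite // invgK.
Qed.

(** If [T] had no adjoint in the algebra, [cadj T] would be the default value 0 and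
    both products would vanish. *)
Lemma tau_cadj T : tau (cadj T * T) = tau (T * cadj T).
Proof.
rewrite /cadj; case: xgetP => [S _|_]; first exact: tau_adjoint.
by rewrite mul0r mulr0.
Qed.

Lemma tau_mx_adj m k (v : 'M[cstar R G]_(m, k)) :
  tau_mx (adjmx (@cadj R G) v *m v) = tau_mx (v *m adjmx (@cadj R G) v).
Proof.
rewrite /tau_mx.
under eq_bigr do rewrite mxE tau_sum.
under [RHS]eq_bigr do rewrite mxE tau_sum.
rewrite exchange_big; apply: eq_bigr => i _; apply: eq_bigr => j _.
by rewrite !mxE tau_cadj.
Qed.

Lemma tau_mx_block m k (p : 'M[cstar R G]_m) (q : 'M[cstar R G]_k) :
  tau_mx (block_mx p 0 0 q) = tau_mx p + tau_mx q.
Proof.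
rewrite /tau_mx big_split_ord; congr (_ + _); apply: eq_bigr => i _.
  by rewrite block_mxEul.
by rewrite block_mxEdr.
Qed.

(** Only the diagonal entries of [p] are seen by the basis vectors, which are
    [delta_1] in one coordinate and 0 in the others. *)
Lemma vn_dim_kazhdan k (L p : 'M[cstar R G]_k) :
  is_kazhdan_projection L p -> vn_dim (ker_mx L) = complex.Re (tau_mx p).
Proof.
move=> [_ pL]; rewrite /vn_dim /tau_mx; congr complex.Re; apply: eq_bigr => i _.
rewrite (orthprojE (@ker_mxB _ _ _ L) (pL _)) /inner_pow.
rewrite (bigD1 i) //= big1 => [|j ji]; last first.
  rewrite /basis_vec (negPf ji) innerC.
  suff -> : inner 0 (mxact p (basis_vec R G i) j) = 0 by rewrite conjc0.
  by rewrite -(subrr 0) innerD innerN subrr.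
rewrite addr0 /mxact (bigD1 i) //= big1 => [|j ji]; last first.
  by rewrite /basis_vec (negPf ji) cstar0.
by rewrite addr0 /basis_vec eqxx.
Qed.

End Trace.

(** * The map induced by the trace on K0 *)

Section InducedMap.
Variables (R : realType) (G : groupType).
Local Notation proj := (projection (@cadj R G)).

Definition free_trace (c : monalg.malg proj int) : R :=
  \sum_(p <- msupp c) complex.Re (tau_mx (pmx p)) *~ mcoeff p c.

Lemma free_traceEw (A : {fset proj}) c : (msupp c `<=` A)%fset ->
  free_trace c = \sum_(p <- A) complex.Re (tau_mx (pmx p)) *~ mcoeff p c.
Proof.
move=> cA; apply: big_fset_incl => // p _ /mcoeff_outdom ->.
exact: mulr0z.
Qed.

Lemma free_traceB c b : free_trace (c - b) = free_trace c - free_trace b.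
Proof.
rewrite (free_traceEw (msuppB_le c b)) (free_traceEw (fsubsetUl _ (msupp b))).
rewrite (free_traceEw (fsubsetUr (msupp c) _)) -sumrB.
by apply: eq_bigr => p _; rewrite mcoeffB mulrzBr.
Qed.

Lemma free_trace0 : free_trace 0 = 0.
Proof. by rewrite -(subrr 0) free_traceB subrr. Qed.

Lemma free_traceD c b : free_trace (c + b) = free_trace c + free_trace b.
Proof. by rewrite -{1}(opprK b) -[- b]sub0r !free_traceB free_trace0 sub0r opprK. Qed.

Lemma free_trace_pgen (p : proj) : free_trace (pgen p) = complex.Re (tau_mx (pmx p)).
Proof. by rewrite (free_traceEw msuppU_le) big_seq_fset1 mcoeffUU. Qed.

(** The kernel of [free_trace] is a subgroup, so it is enough that it contains the
    two kinds of relations, for which [tau_mx_adj] and [tau_mx_block] account. *)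
Lemma K0_null_trace c : K0_null c -> free_trace c = 0.
Proof.
move=> /asboolP/(_ [set c | free_trace c = 0]%classic); apply.
- exact: free_trace0.
- by move=> y z yS zS; rewrite /= free_traceB yS zS subrr.
move=> _ [p q [v [vp vq]]|p q pq] /=.
  by rewrite free_traceB !free_trace_pgen -vp -vq tau_mx_adj subrr.
rewrite free_traceB free_traceD !free_trace_pgen /= tau_mx_block.
by rewrite raddfD subrr.
Qed.

(** The representative chosen by [tau_star] differs from [c] by an element of the
    subgroup of relations. *)
Lemma tau_star_pi (c : monalg.malg proj int) :
  tau_star (\pi_(K0 (@cadj R G)) c)%qT = free_trace c.
Proof.
rewrite -[LHS]/(free_trace (repr _)); apply/subr0_eq; rewrite -free_traceB.
apply: K0_null_trace.
rewrite -[K0_null _]/(_ \in (GRing.ZmodClosed.clone _ (@K0_null _ (@cadj R G)) _)).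
by rewrite Quotient.idealrBE reprK.
Qed.

Lemma tau_star0 : tau_star (0 : K0 (@cadj R G)) = 0.
Proof.
rewrite -[0 in LHS](raddf0 \pi_(K0 (@cadj R G))%qT).
by rewrite tau_star_pi free_trace0.
Qed.

End InducedMap.

Theorem proposition7 (R : realType) (n : nat) (G : groupType)
    (X : EM_space R G) (S : finite_skeleton X n.+1)
    (d : forall i, 'M[gring R G]_(ncell S i.+1, ncell S i))
    (d_codiff : forall i, (i <= n)%N -> is_codifferential (d i))
    (gap : spectral_gap (cstar_laplacian d n))
    (p : 'M[cstar R G]_(ncell S n))
    (pK : is_kazhdan_projection (cstar_laplacian d n) p) :
  tau_star (K0_class (kazhdan_is_projection pK)) = l2_betti d n /\
  (l2_betti d n <> 0 -> K0_class (kazhdan_is_projection pK) <> 0).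
Proof.
have tauE : tau_star (K0_class (kazhdan_is_projection pK)) = l2_betti d n.
  by rewrite tau_star_pi free_trace_pgen /l2_betti (vn_dim_kazhdan pK).
by split=> // betti0 p0; apply: betti0; rewrite -tauE p0 tau_star0.
Qed.
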